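(* Let $p(x)$ be a polynomial over a field $B$ with a splitting field $E$ such that $E\supsetneq B$. If $p(x)$ is separable, or more generally, $p(x)$ is canonically solvable, then there exist $m\in\mathbb{Z}^+$ and $m$ polynomials $p_1(x),\dots,p_m(x)$ such that the Galois group of each $p_i(x)$ is simple and, for any root of $p(x)$ in $E$, there is a formula for that root which only involves rational functions over $B$ on the roots of $p_1(x),\dots,p_m(x)$ in $E$.
   Context: A field extension $F/B$ is an irreducible Galois extension if it is Galois and $\operatorname{Gal}(F/B)$ is a simple group or the trivial group. A field extension $E/B$ is a canonical field extension if there is a tower $B=B_0\subseteq B_1\subseteq\cdots\subseteq B_m=E$ with $m\in\mathbb{Z}^+$ such that each $B_i/B_{i-1}$ is an irreducible Galois extension. A polynomial $p(x)$ is canonically solvable if there is a canonical field extension $E_0/B_0$ such that $p(x)$ is over $B_0$ (has coefficients in $B_0$), $p(x)$ is not over any proper subfield of $B_0$, and $E_0$ is a splitting field of $p(x)$. The polynomials $p_i(x)$ are understood as follows: putting $K_0=B$ and $K_i=K_{i-1}(\text{roots of }p_i\text{ in }E)$, each $p_i(x)$ is a separable polynomial over $K_{i-1}$ that splits in $E$, and the Galois group of $p_i(x)$ is $\operatorname{Gal}(K_i/K_{i-1})$. ''There is a formula which only involves rational functions over $B$ on a set $R$'' for an element of $E$ means that the element is the value of a rational function with coefficients in $B$ at elements of $R$, i.e. it lies in the subfield $B(R)$. *)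

(* Defs.v *)
From HB Require Import structures.
From mathcomp Require Import all_boot all_order all_algebra.
From mathcomp Require Import all_fingroup all_solvable all_field.
From mathcomp Require Import mpoly.

Set Implicit Arguments.
Unset Strict Implicit.
Unset Printing Implicit Defensive.

Import GRing.Theory.
Local Open Scope ring_scope.

Section CanonicalExtension.

(* All fields of a tower live in one splitting field L of finite degree, which
   is where 'Gal(_ / _) is available. *)
Variables (F0 : fieldType) (L : splittingFieldType F0).

Definition irreducible_galois (B F : {subfield L}) : Prop :=
  galois B F /\ (simple 'Gal(F / B) \/ 'Gal(F / B)%g = 1%g).

Definition canonical_extension (B E : {subfield L}) : Prop :=
  exists (m : nat) (T : nat -> {subfield L}),
    [/\ (0 < m)%N, T 0%N = B, T m = E &
        forall i, (i < m)%N -> irreducible_galois (T i) (T i.+1)].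

End CanonicalExtension.

(* A field over which p is defined, and over no proper subfield of which p is
   defined, is generated by the coefficients of p, hence lies in the given
   field B. B is in general of infinite degree over it, so B0 is an abstract
   field with an embedding iota into B, and p0 is p seen over B0. A
   divringClosed predicate on a field is a subfield. *)
Definition canonically_solvable (B : fieldType) (p : {poly B}) : Prop :=
  exists (B0 : fieldType) (iota : {rmorphism B0 -> B}) (p0 : {poly B0})
         (E0 : splittingFieldType B0),
    [/\ p = map_poly iota p0,
        forall S : divringClosed B0, p0 \is a polyOver S -> S =i predT,
        splittingFieldFor 1 (map_poly (in_alg E0) p0) {:E0} &
        canonical_extension (1%AS : {subfield E0}) {:E0}%AS].

(* The rational function f / g with coefficients in B is defined at the point
   t when g does not vanish there, and then takes the value z. *)
Definition rational_formula (B : fieldType) (E : fieldExtType B)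
    (R : {pred E}) (z : E) : Prop :=
  exists (n : nat) (t : 'I_n -> E) (f g : {mpoly B[n]}),
    [/\ forall j, t j \in R,
        mmap (in_alg E) t g != 0 &
        z = mmap (in_alg E) t f / mmap (in_alg E) t g].

(* Main.v *)
Require Import Defs.
From HB Require Import structures.
From mathcomp Require Import all_boot all_order all_algebra.
From mathcomp Require Import all_fingroup all_solvable all_field.
From mathcomp Require Import mpoly.

Set Implicit Arguments.
Unset Strict Implicit.
Unset Printing Implicit Defensive.

Import GRing.Theory.
Local Open Scope ring_scope.

(** Both hypotheses on p make every root of p in E separable over B, so E,
    being generated by these roots and normal, is Galois over B
    (splitting_galois). In the canonically solvable case the tower over B0
    consists of Galois steps, hence E0 is separable over B0; the minimal
    polynomials over B0 of the roots of p in E0 are then separable, and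
    separability of a polynomial survives the change of base iota, so their
    images account for the roots of p in E.

    Once E is Galois over B, a composition series of the Galois group yields,
    through fixed fields, a tower from B to E whose steps are Galois with
    simple group (galois_simple_tower). By the primitive element theorem each
    step K (i + 1) is K i with one element x i adjoined, and q i is the minimal
    polynomial of x i over K i. Thus E is generated over B by
    x 0, ..., x (m - 1), one root of each q i; as these are algebraic, every
    element of E is even a polynomial in them (tower_mem_mmap), which is a
    rational formula with denominator 1. *)

(** The Galois correspondence turns a composition series of the group into the
    tower: a maximal normal subgroup H' of H gives a normal, hence Galois,
    extension of fixed fields, with group isomorphic to the simple group
    H / H'. *)
Lemma galois_simple_tower (F : fieldType) (L : splittingFieldType F)
    (K E : {subfield L}) :
  galois K E ->
  exists (m : nat) (T : nat -> {subfield L}),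
    [/\ T 0%N = K, T m = E &
        forall i, (i < m)%N ->
          galois (T i) (T i.+1) /\ simple 'Gal(T i.+1 / T i)].
Proof.
move=> galKE.
have [s /compsP[lastG seriesG]] := exists_comps 'Gal(E / K)%G.
pose H i : {group gal_of E} := nth 1%G ('Gal(E / K)%G :: s) i.
exists (size s), (fun i => fixedField_aspace (H i)); split.
- by apply: val_inj; apply/galois_fixedField.
- apply: val_inj => /=.
  (* The composition series ends at the trivial group, which fixes all of E. *)
  have -> : H (size s) = 1%G by rewrite -lastG (last_nth 1%G).
  apply/eqP; rewrite eqEsubv fixedField_bound; apply/subvP=> a Ea.
  by apply/fixedFieldP=> // u /set1P->; rewrite gal_id.
- move=> i lt_i_s.
  have maxH : maxnormal (H i.+1) (H i) (H i) by apply: (pathP 1%G seriesG).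
  have nsH : (H i.+1 <| H i)%g := maxnormal_normal maxH.
  have galE : galois (fixedField (H i)) E := fixedField_galois (H i).
  have galHH : galois (fixedField (H i)) (fixedField (H i.+1)).
    by apply: (normal_fixedField_galois galE); rewrite gal_fixedField.
  split=> //=.
  have [sHH _ nHH] := and3P galHH.
  have sub : (fixedField (H i) <= fixedField (H i.+1) <= E)%VS.
    by rewrite sHH fixedField_bound.
  have /= := isog_simple (normalField_isog galE sub nHH).
  by rewrite !gal_fixedField quotient_simple // => <-.
Qed.

(** In a normal extension all conjugates of a primitive element are present, so
    its minimal polynomial alone has the whole extension as splitting field. *)
Lemma minPoly_splitting (F : fieldType) (L : splittingFieldType F)
    (K E : {subfield L}) (x : L) :
  normalField K E -> <<K; x>>%VS = E -> splittingFieldFor K (minPoly K x) E.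
Proof.
move=> normE defE; have Ex : x \in E by rewrite -defE memv_adjoin.
have [r /allP rE Dp] := normalFieldP normE x Ex.
exists r; first by rewrite Dp eqpxx.
apply/eqP; rewrite eqEsubv; apply/andP; split.
  apply/Fadjoin_seqP; split; last exact: rE.
  by rewrite -defE subv_adjoin.
rewrite -defE; apply/FadjoinP; split; first exact: subv_adjoin_seq.
apply: seqv_sub_adjoin.
by rewrite -root_prod_XsubC -Dp root_minPoly.
Qed.

(** By induction along the tower: an element of K (i + 1) is a polynomial in
    x i whose coefficients lie in K i, hence are themselves polynomial
    expressions in the generators. All expressions use the same m
    variables, so that sums and products are immediate. *)
Lemma tower_mem_mmap (B : fieldType) (E : fieldExtType B) (m : nat)
    (K : nat -> {subfield E}) (x : 'I_m -> E) :
  K 0%N = 1%AS ->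
  (forall i : 'I_m, K i.+1 = <<K i; x i>>%VS :> {vspace E}) ->
  forall z, z \in K m -> exists f : {mpoly B[m]}, z = mmap (in_alg E) x f.
Proof.
move=> K0 Kx.
suff IH k : (k <= m)%N -> forall z, z \in K k ->
    exists f : {mpoly B[m]}, z = mmap (in_alg E) x f by exact: IH.
elim: k => [_ z | k IHk lt_k_m z].
  rewrite K0 => /vlineP[c ->]; exists c%:MP.
  by rewrite mmapC.
rewrite (Kx (Ordinal lt_k_m)) => /Fadjoin_polyP[p /polyOverP Kp ->] /=.
rewrite horner_coef; elim/big_ind: _ => [|_ _ [f ->] [g ->]|i _].
- by exists 0; rewrite mmap0.
- by exists (f + g); rewrite mmapD.
have [f ->] := IHk (ltnW lt_k_m) _ (Kp i).
exists (f * 'X_(Ordinal lt_k_m) ^+ i).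
by rewrite rmorphM rmorphXn /= mmapX mmap1U.
Qed.

Lemma canonical_extension_separable (F : fieldType) (L : splittingFieldType F)
    (B E : {subfield L}) :
  canonical_extension B E -> separable B E.
Proof.
move=> [m [T [_ <- <- galT]]]; elim: m galT => [|m IHm] galT.
  exact: separable_refl.
apply: (separable_trans (IHm _)) => [i /leqW/galT //|].
by have [/and3P[]] := galT m (ltnSn m).
Qed.

(** The minimal polynomials of the roots of p in L have coefficients in F, and
    their product, with one factor for each occurrence of a root, is divisible
    by p. This expresses the separability of the roots of p over F itself, in a
    form that can be transported along any embedding of F into another field:
    the separable factors stay separable and the divisibility is preserved. *)
Lemma dvdp_separable_prod (F : fieldType) (L : fieldExtType F) (p : {poly F}) :
  separable 1 {:L} -> splittingFieldFor 1 (map_poly (in_alg L) p) {:L} ->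
  exists2 ms : seq {poly F}, all separable_poly ms & p %| \prod_(q <- ms) q.
Proof.
move=> /separableP sepL [rs Dp _].
suff [ms sep_ms dvd_ms] : exists2 ms : seq {poly F}, all separable_poly ms &
    \prod_(z <- rs) ('X - z%:P) %| map_poly (in_alg L) (\prod_(q <- ms) q).
  by exists ms => //; rewrite -(dvdp_map (in_alg L)) (eqp_dvdl _ Dp).
elim: rs {Dp} => [|z rs [ms sep_ms dvd_ms]].
  by exists [::]; rewrite ?big_nil ?dvd1p.
have /polyOver1P[q Dq] := minPolyOver 1 z.
exists (q :: ms); rewrite /= ?sep_ms ?andbT.
  by rewrite -(separable_map (in_alg L)) -Dq; apply: sepL; apply: memvf.
by rewrite !big_cons rmorphM /= dvdp_mul // -Dq dvdp_XsubCl root_minPoly.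
Qed.

(** Instead of embedding E0 into E, the divisibility over B0 is carried
    to E by B0 -> B -> E, and shows that z is a root of the image of one of the
    separable factors. *)
Lemma canonically_solvable_root_separable (B : fieldType) (E : fieldExtType B)
    (p : {poly B}) (z : E) :
  canonically_solvable p -> root (map_poly (in_alg E) p) z ->
  separable_element 1 z.
Proof.
move=> [B0 [iota [p0 [E0 [-> _ splitE0 canE0]]]]] pz0.
have [ms /allP sep_ms] :=
  dvdp_separable_prod (canonical_extension_separable canE0) splitE0.
rewrite -(dvdp_map (in_alg E \o iota)) map_poly_comp => dvd_p.
have: root (map_poly (in_alg E \o iota) (\prod_(q <- ms) q)) z.
  by rewrite -dvdp_XsubCl (dvdp_trans _ dvd_p) // dvdp_XsubCl.
rewrite rmorph_prod -(big_map _ predT id) -[root _ z]negbK root_bigmul.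
rewrite all_map => /allPn[q ms_q /negbNE qz0]; apply/separable_elementP.
exists (map_poly (in_alg E \o iota) q); split=> //.
  by rewrite map_poly_comp; apply/polyOver1P; exists (map_poly iota q).
by rewrite separable_map sep_ms.
Qed.

Lemma splitting_galois (B : fieldType) (E : splittingFieldType B)
    (p : {poly B}) :
  splittingFieldFor 1 (map_poly (in_alg E) p) {:E} ->
  (forall z : E, root (map_poly (in_alg E) p) z -> separable_element 1 z) ->
  galois 1 {:E}.
Proof.
move=> [rs Dp defE] sep_root; apply/and3P; split.
- exact: sub1v.
- rewrite -defE; apply: separable_Fadjoin_seq; apply/allP=> z rs_z.
  by apply: sep_root; rewrite (eqp_root Dp) root_prod_XsubC.
- exact: normalFieldf 1%AS.
Qed.

Theorem corollary15p2p5 (B : fieldType) (E : splittingFieldType B)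
    (p : {poly B})
    (splitE : splittingFieldFor 1 (map_poly (in_alg E) p) {:E})
    (properE : {:E}%VS != 1%VS)
    (solvp : separable_poly p \/ canonically_solvable p) :
  exists (m : nat) (q : 'I_m -> {poly E}) (K : nat -> {subfield E}),
    [/\ (0 < m)%N,
        K 0%N = 1%AS,
        forall i : 'I_m,
          [/\ q i \is a polyOver (K i), separable_poly (q i),
              splittingFieldFor (K i) (q i) (K i.+1) &
              simple 'Gal(K i.+1 / K i)] &
        forall z : E, root (map_poly (in_alg E) p) z ->
          rational_formula [pred x : E | [exists i, root (q i) x]] z].
Proof.
have galE : galois 1 {:E}.
  apply: (splitting_galois splitE) => z pz0.
  case: solvp => [sep_p | /canonically_solvable_root_separable]; last exact.
  apply/separable_elementP; exists (map_poly (in_alg E) p); split=> //.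
    by apply/polyOver1P; exists p.
  by rewrite separable_map.
have [m [K [K0 Km stepK]]] := galois_simple_tower (E := {:E}%AS) galE.
pose x (i : 'I_m) := separable_generator (K i) (K i.+1).
have Kx (i : 'I_m) : K i.+1 = <<K i; x i>>%VS :> {vspace E}.
  have [/and3P[sK sepK _] _] := stepK i (ltn_ord i).
  exact: eq_adjoin_separable_generator.
exists m, (fun i : 'I_m => minPoly (K i) (x i)), K; split=> // [|i|z _].
- (* A tower of length 0 would give E = B. *)
  rewrite lt0n; apply: contraNneq properE => m0.
  by rewrite -[{:E}%VS]/(val {:E}%AS) -Km m0 K0.
- have [/and3P[_ _ normK] simpleK] := stepK i (ltn_ord i).
  split=> //; first exact: minPolyOver.
    exact: separable_generatorP.
  by apply: minPoly_splitting.
- have [|f ->] := tower_mem_mmap (z := z) K0 Kx.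
    by rewrite Km memvf.
  exists m, x, f, 1; split=> [j||].
  + by apply/existsP; exists j; apply: root_minPoly.
  + by rewrite rmorph1 oner_eq0.
  + by rewrite rmorph1 divr1.
Qed.
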